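(* If $K=K_i$ for all $i\in[1,k]$, the number of irreducible modules of $L\wr G$ (up to isomorphism) is given by the number of conjugacy classes of $N$.
   Context: A finite group $G$ acts (from the right, $y\mapsto y^\sigma$, by field automorphisms, not necessarily faithfully) on a field $L$ with fixed field $K$. Let $N$ be the kernel of this operation, and assume that $n=|N|$ is invertible in $K$. The twisted group ring $L\wr G$ is the $K$-algebra which as a right $L$-vector space has basis $G$, with multiplication determined by $(\sigma y)(\tau z)=(\sigma\tau)(y^\tau z)$ for $\sigma,\tau\in G$, $y,z\in L$. It is semisimple. $X_1,\dots,X_k$ are representatives of the isomorphism classes of simple right $L\wr G$-modules, and $K_i=\operatorname{End}_{L\wr G}X_i$ is the endomorphism skew field (containing $K$). *)

(* Defs.v *)
From HB Require Import structures.
From mathcomp Require Import all_boot all_order all_fingroup all_algebra.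
From mathcomp Require Import boolp.

Set Implicit Arguments.
Unset Strict Implicit.
Unset Printing Implicit Defensive.

Import GroupScope GRing.Theory.
Local Open Scope ring_scope.

(* [{action gT &-> L}] is a right action: to y (s * t) = to (to y s) t.       *)
Record field_action (gT : finGroupType) (L : fieldType) := FieldAction {
  field_act :> {action gT &-> L};
  field_act_zmod : forall s : gT, GRing.zmod_morphism (field_act^~ s);
  field_act_monoid : forall s : gT, GRing.monoid_morphism (field_act^~ s)
}.

Definition action_mor (gT : finGroupType) (L : fieldType)
  (to : field_action gT L) (s : gT) : L -> L := fun y => to y s.

HB.instance Definition _ (gT : finGroupType) (L : fieldType)
    (to : field_action gT L) (s : gT) :=
  GRing.isZmodMorphism.Build L L (action_mor to s) (field_act_zmod to s).
HB.instance Definition _ (gT : finGroupType) (L : fieldType)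
    (to : field_action gT L) (s : gT) :=
  GRing.isMonoidMorphism.Build L L (action_mor to s) (field_act_monoid to s).

Section FieldAction.

Variables (gT : finGroupType) (L : fieldType) (to : field_action gT L).
Implicit Types (s t : gT) (y z : L).

Lemma field_actM s t y : to y (s * t)%g = to (to y s) t.
Proof. by case: (field_act to) => act [_ actM] /=; rewrite actM ?inE. Qed.

Lemma field_act1 y : to y 1%g = y.
Proof.
have [inj_to _] : is_action setT to by case: (field_act to).
by apply: (inj_to 1%g); rewrite -field_actM mulg1.
Qed.

Definition action_kernel : {set gT} :=
  [set s | `[< forall y : L, to y s = y >]].

Lemma action_kernel_group_set : group_set action_kernel.
Proof.
apply/group_setP; split=> [|s t].
  by rewrite inE; apply/asboolP=> y; exact: field_act1.
rewrite !inE => /asboolP sid /asboolP tid; apply/asboolP=> y.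
by rewrite field_actM sid tid.
Qed.
Canonical action_kernel_group := Group action_kernel_group_set.

Definition fixed_pred : pred L := fun y => [forall s, to y s == y].

Lemma fixed_predP y : reflect (forall s, to y s = y) (y \in fixed_pred).
Proof. exact: 'forall_eqP. Qed.

Lemma fixed_pred_divring : divring_closed fixed_pred.
Proof.
split=> [|y z /fixed_predP fy /fixed_predP fz|y z /fixed_predP fy /fixed_predP fz];
  apply/fixed_predP => s; rewrite -/(action_mor to s _).
- exact: rmorph1.
- by rewrite rmorphB /= /action_mor fy fz.
by rewrite fmorph_div /= /action_mor fy fz.
Qed.

HB.instance Definition _ :=
  GRing.isDivringClosed.Build L fixed_pred fixed_pred_divring.

Record fixed_field :=
  FixedField { fixed_val :> L; fixed_valP : fixed_val \in fixed_pred }.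

HB.instance Definition _ := [isSub for fixed_val].
HB.instance Definition _ := [Choice of fixed_field by <:].
HB.instance Definition _ := [SubChoice_isSubIntegralDomain of fixed_field by <:].
HB.instance Definition _ := [SubIntegralDomain_isSubField of fixed_field by <:].

Lemma field_act_scale s y (c : fixed_field) :
  to (y * fixed_val c) s = to y s * fixed_val c.
Proof.
rewrite -[LHS]/(action_mor to s _) rmorphM; congr (_ * _).
exact: (fixed_predP _ (fixed_valP c)).
Qed.

End FieldAction.

(* The family [f] represents the sum over s of s (f s), so that the right     *)
(* L-vector space on the basis G is [{ffun gT -> L}]. The parameter [to] is a *)
(* tag: it selects the multiplication below.                                  *)
Definition twisted_ring (gT : finGroupType) (L : fieldType)
  (to : field_action gT L) : Type := {ffun gT -> L}.

HB.instance Definition _ (gT : finGroupType) (L : fieldType)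
  (to : field_action gT L) := GRing.Zmodule.on (twisted_ring to).

Section TwistedRing.

Variables (gT : finGroupType) (L : fieldType) (to : field_action gT L).
Implicit Types (s t : gT) (y z : L).
Local Notation fixed_field := (fixed_field to).
Local Notation twisted_ring := (twisted_ring to).

Implicit Types f g h : twisted_ring.

Definition twisted_mono s y : twisted_ring :=
  [ffun t : gT => if t == s then y else 0].

Definition twisted_mul f g : twisted_ring :=
  \sum_s \sum_t twisted_mono (s * t)%g (to (f s) t * g t).

Fact twisted_mono_is_zmod_morphism s : zmod_morphism (twisted_mono s).
Proof. by move=> y z; apply/ffunP=> t; rewrite !ffunE; case: eqP; rewrite ?subr0. Qed.

HB.instance Definition _ s :=
  GRing.isZmodMorphism.Build L twisted_ring (twisted_mono s)
    (twisted_mono_is_zmod_morphism s).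

Lemma twisted_sumE f : f = \sum_s twisted_mono s (f s).
Proof.
apply/ffunP=> t; rewrite sum_ffunE (bigD1 t) //= ffunE eqxx big1 ?addr0 // => s nst.
by rewrite ffunE eq_sym (negPf nst).
Qed.

Lemma twisted_mulDl : left_distributive twisted_mul +%R.
Proof.
move=> f g h; rewrite /twisted_mul -big_split; apply: eq_bigr => s _ /=.
rewrite -big_split; apply: eq_bigr => t _ /=.
by rewrite ffunE -![to _ t]/(action_mor to t _) rmorphD mulrDl raddfD.
Qed.

Lemma twisted_mulDr : right_distributive twisted_mul +%R.
Proof.
move=> f g h; rewrite /twisted_mul -big_split; apply: eq_bigr => s _ /=.
rewrite -big_split; apply: eq_bigr => t _ /=.
by rewrite ffunE mulrDr raddfD.
Qed.

Lemma twisted_mul_suml (I : Type) (r : seq I) (F : I -> twisted_ring) g :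
  twisted_mul (\sum_(i <- r) F i) g = \sum_(i <- r) twisted_mul (F i) g.
Proof.
apply: (big_morph (twisted_mul^~ g) (fun f h => twisted_mulDl f h g)).
by apply: (addrI (twisted_mul 0 g)); rewrite -twisted_mulDl !addr0.
Qed.

Lemma twisted_mul_sumr (I : Type) (r : seq I) (F : I -> twisted_ring) g :
  twisted_mul g (\sum_(i <- r) F i) = \sum_(i <- r) twisted_mul g (F i).
Proof.
apply: (big_morph (twisted_mul g) (twisted_mulDr g)).
by apply: (addrI (twisted_mul g 0)); rewrite -twisted_mulDr !addr0.
Qed.

Lemma twisted_monoM s t y z :
  twisted_mul (twisted_mono s y) (twisted_mono t z)
  = twisted_mono (s * t)%g (to y t * z).
Proof.
rewrite /twisted_mul (bigD1 s) //= (bigD1 t) //= !ffunE !eqxx.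
rewrite [X in _ + X + _]big1 => [|t' nt]; last first.
  by rewrite [X in _ * X]ffunE (negPf nt) mulr0 raddf0.
rewrite addr0 big1 ?addr0 // => s' ns; rewrite big1 // => t' _.
by rewrite ffunE (negPf ns) -[to _ t']/(action_mor to t' _) rmorph0 mul0r raddf0.
Qed.

Lemma twisted_mulA : associative twisted_mul.
Proof.
move=> f g h; rewrite (twisted_sumE f) (twisted_sumE g) (twisted_sumE h).
rewrite !twisted_mul_suml; apply: eq_bigr => s _.
rewrite [in LHS]twisted_mul_sumr (twisted_mul_sumr _ _ (twisted_mono s _)).
rewrite [in RHS]twisted_mul_suml.
apply: eq_bigr => t _; rewrite !twisted_mul_sumr; apply: eq_bigr => u _.
rewrite !twisted_monoM mulgA -![to _ _]/(action_mor to _ _).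
by rewrite rmorphM /= /action_mor field_actM mulrA.
Qed.

Lemma twisted_mul1l : left_id (twisted_mono 1%g 1) twisted_mul.
Proof.
move=> f; rewrite [in RHS](twisted_sumE f) {1}(twisted_sumE f) twisted_mul_sumr.
apply: eq_bigr => s _; rewrite twisted_monoM mul1g -[to _ s]/(action_mor to s _).
by rewrite rmorph1 mul1r.
Qed.

Lemma twisted_mul1r : right_id (twisted_mono 1%g 1) twisted_mul.
Proof.
move=> f; rewrite [in RHS](twisted_sumE f) {1}(twisted_sumE f) twisted_mul_suml.
by apply: eq_bigr => s _; rewrite twisted_monoM mulg1 mulr1 field_act1.
Qed.

Lemma twisted_1_neq0 : twisted_mono 1%g 1 != 0.
Proof.
by apply/eqP=> /ffunP/(_ 1%g); rewrite !ffunE eqxx; apply/eqP; rewrite oner_eq0.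
Qed.

HB.instance Definition _ := GRing.Zmodule_isNzRing.Build twisted_ring
  twisted_mulA twisted_mul1l twisted_mul1r twisted_mulDl twisted_mulDr
  twisted_1_neq0.

Lemma twisted_ring_monoM s t y z :
  (twisted_mono s y : twisted_ring) * twisted_mono t z
  = twisted_mono (s * t)%g (to y t * z).
Proof. exact: twisted_monoM. Qed.

(* Only K, and not L, acts centrally: the algebra structure is over K.        *)
Definition twisted_scale (c : fixed_field) f : twisted_ring :=
  [ffun s => f s * fixed_val c].

Fact twisted_scaleA c d f :
  twisted_scale c (twisted_scale d f) = twisted_scale (c * d) f.
Proof. by apply/ffunP=> s; rewrite !ffunE -mulrA [fixed_val d * _]mulrC. Qed.

Fact twisted_scale1 : left_id 1 twisted_scale.
Proof. by move=> f; apply/ffunP=> s; rewrite !ffunE mulr1. Qed.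

Fact twisted_scaleDr : right_distributive twisted_scale +%R.
Proof. by move=> c f g; apply/ffunP=> s; rewrite !ffunE mulrDl. Qed.

Fact twisted_scaleDl f : {morph twisted_scale^~ f : c d / c + d}.
Proof. by move=> c d; apply/ffunP=> s; rewrite !ffunE mulrDr. Qed.

HB.instance Definition _ := GRing.Zmodule_isLmodule.Build fixed_field twisted_ring
  twisted_scaleA twisted_scale1 twisted_scaleDr twisted_scaleDl.

Lemma twisted_scale_mono (c : fixed_field) s y :
  c *: (twisted_mono s y : twisted_ring) = twisted_mono s (y * fixed_val c).
Proof. by apply/ffunP=> t; rewrite !ffunE; case: eqP; rewrite ?mul0r. Qed.

Fact twisted_scaleAl (c : fixed_field) f g : c *: (f * g) = (c *: f) * g.
Proof.
rewrite (twisted_sumE f) (twisted_sumE g) mulr_suml.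
rewrite [in RHS]scaler_sumr mulr_suml scaler_sumr; apply: eq_bigr => s _.
rewrite !mulr_sumr scaler_sumr; apply: eq_bigr => t _.
rewrite twisted_scale_mono !twisted_ring_monoM twisted_scale_mono.
by rewrite field_act_scale -!mulrA [z in _ * z]mulrC.
Qed.

HB.instance Definition _ :=
  GRing.Lmodule_isLalgebra.Build fixed_field twisted_ring twisted_scaleAl.

Fact twisted_scaleAr (c : fixed_field) f g : c *: (f * g) = f * (c *: g).
Proof.
rewrite (twisted_sumE f) (twisted_sumE g) !mulr_suml scaler_sumr.
apply: eq_bigr => s _; rewrite [in RHS]scaler_sumr !mulr_sumr scaler_sumr; apply: eq_bigr => t _.
by rewrite twisted_scale_mono !twisted_ring_monoM twisted_scale_mono mulrA.
Qed.

HB.instance Definition _ :=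
  GRing.Lalgebra_isAlgebra.Build fixed_field twisted_ring twisted_scaleAr.

End TwistedRing.

(* Right modules over a ring A are left modules over the converse ring A^c;   *)
(* the right action x a is then written [(a : A^c) *: x].                     *)
Definition simple_module (R : pzRingType) (V : lmodType R) : Prop :=
  (exists x : V, x != 0) /\
  (forall S : {pred V}, GRing.submod_closed S ->
     (forall x, x \in S -> x = 0) \/ (forall x, x \in S)).

Definition isomorphic_modules (R : pzRingType) (V W : lmodType R) : Prop :=
  exists f : {linear V -> W}, bijective f.

Definition simple_representatives (R : pzRingType) (k : nat)
    (X : 'I_k -> lmodType R) : Prop :=
  [/\ forall i, simple_module (X i),
      forall i j, isomorphic_modules (X i) (X j) -> i = j
    & forall V : lmodType R, simple_module V ->
        exists i, isomorphic_modules V (X i)].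

(* The map K -> End_A X, c |-> (x |-> x (c 1_A)), for a right module X over   *)
(* the K-algebra A; it is injective as soon as X is nonzero.                  *)
Definition scalar_endo (K : fieldType) (A : algType K) (X : lmodType A^c)
  (c : K) : X -> X := fun x => ((c%:A : A) : A^c) *: x.

Fact scalar_endo_is_linear (K : fieldType) (A : algType K) (X : lmodType A^c)
  (c : K) : linear (scalar_endo (X := X) c).
Proof.
move=> a x y; rewrite /scalar_endo scalerDr !scalerA; congr (_ *: _ + _).
by rewrite -[LHS]/((a : A) * c%:A) -[RHS]/(c%:A * (a : A)) mulr_algl mulr_algr.
Qed.

HB.instance Definition _ (K : fieldType) (A : algType K) (X : lmodType A^c)
    (c : K) :=
  GRing.isLinear.Build A^c X X *:%R (scalar_endo (X := X) c)
    (scalar_endo_is_linear (X := X) c).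

(* K = End_A X, for K viewed inside End_A X through [scalar_endo].            *)
Definition endomorphisms_are_scalars (K : fieldType) (A : algType K)
    (X : lmodType A^c) : Prop :=
  forall phi : {linear X -> X}, exists c : K, phi =1 scalar_endo c.

(* Main.v *)
Require Import Defs.
From HB Require Import structures.
From mathcomp Require Import all_boot all_order all_fingroup all_algebra.
From mathcomp Require Import boolp.

Set Implicit Arguments.
Unset Strict Implicit.
Unset Printing Implicit Defensive.

Import GroupScope GRing.Theory.
Local Open Scope ring_scope.

(* Write A for the twisted group ring and N for the kernel of the action.     *)
(* Artin's separation argument gives a_j, b_j in L whose sums of (b_j^s) a_j  *)
(* are 1 for s in N and 0 otherwise. As |N| is invertible, this yields an     *)
(* element of L of trace 1, with which Maschke's averaging argument           *)
(* works for right ideals, even if |G| vanishes in L. Hence A is a sum of     *)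
(* images of the X_i, and there are e_i in A acting on X_j as the Kronecker   *)
(* delta; they are central because A acts faithfully on the sum of the X_i.   *)
(* The e_i form an L-basis of the L-valued functions on N that are constant   *)
(* on N-classes: an element of Z(A) acts on X_i by a scalar of K, hence is    *)
(* a K-combination of the e_i, and a class function w is recovered from       *)
(* the central elements T(w b_j) as |N|^-1 times the sum of the T(w b_j) a_j, *)
(* where T(u) is the sum of the s^-1 u s. The indicator functions of the      *)
(* classes of N are another basis of this space.                              *)

(** Both numbers are the L-dimension of one space, the L-span of the centre of A. [ideal_in_socle],
    resting on [maschke], provides the central [e i], and endomorphisms being scalars puts the
    centre inside their L-span. [central_kernel_class_fun] and [kernel_class_fun_descent] identify
    the L-span of the centre with the class functions on N. The descent is needed because
    conjugation by G may permute the N-classes, so a single class indicator need not be central. *)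

Section Submodule.

Variables (R : pzRingType) (V : lmodType R) (S : {pred V}).
Hypothesis S_closed : GRing.submod_closed S.

(* The unused argument lets the closure instance below depend on the proof. *)
Definition submodule_pred of GRing.submod_closed S : {pred V} := S.
Local Notation P := (submodule_pred S_closed).

HB.instance Definition _ := GRing.isSubmodClosed.Build R V P S_closed.

Record submodule := Submodule { submodule_val : V; _ : submodule_val \in P }.

HB.instance Definition _ := [isSub for submodule_val].
HB.instance Definition _ := [Choice of submodule by <:].
HB.instance Definition _ := [SubChoice_isSubLmodule of submodule by <:].

End Submodule.

(** * Schur's lemma and simple submodules *)

Section Simple.

Variable R : pzRingType.
Implicit Types V W : lmodType R.

Lemma schur V W (f : {linear V -> W}) :
  simple_module V -> simple_module W -> (exists x, f x != 0) ->
  isomorphic_modules V W.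
Proof.
move=> [_ simV] [_ simW] [x fx]; exists f.
have f_inj : injective f.
  have [|ker0|kerT] := simV [pred y | f y == 0].
  - split=> [|a u v]; rewrite !inE ?raddf0 // => /eqP fu /eqP fv.
    by rewrite linearP fu fv scaler0 addr0.
  - by move=> y z /eqP; rewrite -subr_eq0 -raddfB => /ker0/subr0_eq.
  - by have := kerT x; rewrite inE (negPf fx).
have f_surj w : exists v, f v = w.
  have [|im0|imT] := simW [pred w | `[< exists v, f v = w >]].
  - split=> [|a u v]; rewrite !inE.
      by apply/asboolP; exists 0; rewrite raddf0.
    move=> /asboolP[u' <-] /asboolP[v' <-]; apply/asboolP.
    by exists (a *: u' + v'); rewrite linearP.
  - have /im0/eqP : f x \in [pred w | `[< exists v, f v = w >]].
      by rewrite inE; apply/asboolP; exists x.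
    by rewrite (negPf fx).
  - by have := imT w; rewrite inE => /asboolP.
have g_ex w : {v | f v = w} by apply: cid.
by exists (fun w => sval (g_ex w)) => [v|w]; [apply: f_inj|]; case: (g_ex _).
Qed.

Section Representatives.

Variables (k : nat) (X : 'I_k -> lmodType R).
Hypothesis hX : simple_representatives X.

(** Each nonzero element generates [S], so [S] is simple and isomorphic to some [X i]; the map is
    the inverse isomorphism followed by the inclusion. *)
Lemma cyclic_submodule_image V (S : {pred V}) :
  GRing.submod_closed S -> (exists2 x, x \in S & x != 0) ->
  (forall x y, x \in S -> x != 0 -> y \in S -> exists a : R, y = a *: x) ->
  exists i, exists f : {linear X i -> V}, forall y, y \in S -> exists x, y = f x.
Proof.
move=> clS [x0 Sx0 nz0] cycS; have [_ _ simX] := hX.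
have [|i [g [h gK hK]]] := simX (submodule clS).
- split; first by exists (Submodule (Sx0 : x0 \in submodule_pred clS)).
  move=> T [T0 clT]; have [T_0|/existsNP[x /not_implyP[Tx /eqP nz]]] :=
    pselect (forall x, x \in T -> x = 0); [by left | right => y].
  have [a def_y] : exists a, val y = a *: val x.
    by apply: cycS; [exact: (valP x) | | exact: (valP y)].
  have -> : y = a *: x + 0 by apply: val_inj; rewrite addr0 def_y.
  exact: clT.
have h_lin : linear h.
  by move=> a u v; apply: (can_inj gK); rewrite linearP !hK.
pose hM := GRing.isLinear.Build _ _ _ _ h h_lin.
pose H : {linear X i -> submodule clS} := HB.pack h hM.
exists i, (val \o H : {linear X i -> V}) => y Sy.
exists (g (Submodule (Sy : y \in submodule_pred clS))).
by rewrite /= gK.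
Qed.

End Representatives.

End Simple.

(** * Elements separating the simple modules *)

Section Socle.

Variables (R : nzRingType) (k : nat) (X : 'I_k -> lmodType R).
Hypothesis hX : simple_representatives X.

Definition annihilates (a : R) := forall i (x : X i), a *: x = 0.

(** Two properties that sums of images of the [X i] in the regular module have. At [a = 1] they give
    the components of the identity and faithfulness on the sum of the [X i]. *)
Definition in_socle (a : R) :=
  (exists2 e : 'I_k -> R, a = \sum_i e i &
     forall i j (x : X j), i != j -> e i *: x = 0)
  /\ (forall b, annihilates b -> b * a = 0).

Lemma in_socle0 : in_socle 0.
Proof.
split=> [|b _]; last by rewrite mulr0.
by exists (fun=> 0) => [|i j x _]; rewrite ?big1 ?scale0r.
Qed.

Lemma in_socleD a b : in_socle a -> in_socle b -> in_socle (a + b).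
Proof.
move=> [[e -> he] ha] [[e' -> he'] hb]; split=> [|c hc].
  exists (fun i => e i + e' i) => [|i j x nij]; first by rewrite big_split.
  by rewrite scalerDl he ?he' ?addr0.
by rewrite mulrDr ha ?hb ?addr0.
Qed.

Lemma in_socle_image i (f : {linear X i -> R^o}) y : in_socle (f y : R).
Proof.
have [simX injX _] := hX.
split; last first.
  by move=> b hb; rewrite -[b * _]/(b *: f y) -linearZ hb raddf0.
exists (fun j => if j == i then f y : R else 0) => [|j l x].
  by rewrite (bigD1 i) //= eqxx big1 ?addr0 // => j /negPf->.
have [->{j}|] := eqVneq j i; last by rewrite scale0r.
move=> nil; apply/eqP/negPn/negP => nz.
(* If [f y] moved some [x] of [X l], this map would be a nonzero morphism from [X i] to [X l],
   against Schur. *)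
pose h z : X l := (f z : R) *: x.
have h_lin : linear h.
  by move=> a u v; rewrite /h linearP /= scalerDl scalerA.
pose hM := GRing.isLinear.Build _ _ _ _ h h_lin.
pose H : {linear X i -> X l} := HB.pack h hM.
have /injX il : isomorphic_modules (X i) (X l).
  by apply: (@schur _ _ _ H) => //; exists y.
by rewrite il eqxx in nil.
Qed.

End Socle.

Section SocleIdempotents.

Variables (R : nzRingType) (k : nat) (X : 'I_k -> lmodType R).

Lemma in_socle1_idempotents : in_socle X 1 ->
  exists e : 'I_k -> R, [/\ forall i (x : X i), e i *: x = x,
    forall i j (x : X j), i != j -> e i *: x = 0
  & forall b, annihilates X b -> b = 0].
Proof.
move=> [[e sum_e e0] faith]; exists e; split=> // [i x|b /faith].
  rewrite -[RHS]scale1r sum_e scaler_suml (bigD1 i) //= big1 ?addr0 // => j nji.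
  exact: e0.
by rewrite mulr1.
Qed.

End SocleIdempotents.

(** * Artin separation and an element of trace 1 *)

Section Separation.

Variables (gT : finGroupType) (L : fieldType) (to : field_action gT L).
Local Notation N := (action_kernel to).
Implicit Types (s t u : gT) (y z : L) (phi psi : gT -> L).

(* [phi] is the image of an element of the tensor product of L with itself. *)
Definition tensorial phi :=
  exists r : seq (L * L), forall s, phi s = \sum_(p <- r) to p.1 s * p.2.

Lemma tensorial_affine y a b : tensorial (fun s => to y s * a + b).
Proof.
exists [:: (y, a); (1, b)] => s; rewrite big_cons big_seq1 /=.
by rewrite -[to 1 s]/(action_mor to s 1) rmorph1 mul1r.
Qed.

Lemma tensorialM phi psi :
  tensorial phi -> tensorial psi -> tensorial (fun s => phi s * psi s).
Proof.
move=> [r phiE] [r' psiE].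
exists [seq (p.1 * q.1, p.2 * q.2) | p <- r, q <- r'] => s.
rewrite big_allpairs_dep phiE psiE mulr_suml; apply: eq_bigr => p _.
rewrite mulr_sumr; apply: eq_bigr => q _ /=.
by rewrite -![to _ s]/(action_mor to s _) rmorphM mulrACA.
Qed.

Lemma action_kernelP s : reflect (forall y, to y s = y) (s \in N).
Proof. by rewrite inE; apply: asboolP. Qed.

(** For each [u] outside N pick [y] moved by [u]: the function (y^s - y^u) / (y - y^u) of [s] is 1
    on N and 0 at [u]. The product of these over all such [u] is the indicator of N. *)
Lemma tensorial_kernel : tensorial (fun s => (s \in N)%:R).
Proof.
suff [phi phiT [phi1 phi0]] : exists2 phi, tensorial phi &
    (forall s, s \in N -> phi s = 1) /\
    (forall s, s \in enum (~: N) -> phi s = 0).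
  have [r phiE] := phiT; exists r => s; rewrite -phiE.
  have [/phi1-> //|sN] := boolP (s \in N).
  by rewrite phi0 // mem_enum inE.
have : {subset enum (~: N) <= ~: N} by move=> s; rewrite mem_enum.
elim: (enum _) => [|u q IHq] subq.
  exists (fun s => to 0 s * 0 + 1); first exact: tensorial_affine.
  by split=> // s _; rewrite mulr0 add0r.
have [phi phiT [phi1 phi0]] : exists2 phi, tensorial phi &
    (forall s, s \in N -> phi s = 1) /\ (forall s, s \in q -> phi s = 0).
  by apply: IHq => s sq; apply: subq; rewrite inE sq orbT.
have := subq u (mem_head u q); rewrite inE => /action_kernelP/existsNP[y yu].
have nz : y - to y u != 0 by rewrite subr_eq0 eq_sym; apply/eqP.
pose psi s := to y s * (y - to y u)^-1 + - to y u / (y - to y u).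
exists (fun s => psi s * phi s).
  by apply: tensorialM => //; apply: tensorial_affine.
split=> s; rewrite /psi -mulrDl.
  by move=> sN; rewrite phi1 // (action_kernelP _ sN) divff ?mulr1.
rewrite inE => /predU1P[->|/phi0->]; last exact: mulr0.
by rewrite subrr !mul0r.
Qed.

Hypothesis N_neq0 : (#|N|%:R : L) != 0.

(** Summing the separation identity over G writes |N| as an L-combination of traces, so some trace
    is nonzero. It is fixed by G, so dividing by it is compatible with the trace. *)
Lemma exists_trace1 : exists y, \sum_s to y s = 1.
Proof.
have [r rE] := tensorial_kernel.
have trN : \sum_(p <- r) (\sum_s to p.1 s) * p.2 = #|N|%:R.
  under eq_bigr do rewrite mulr_suml.
  rewrite exchange_big /=; under eq_bigr do rewrite -rE.
  rewrite -sum1_card natr_sum [RHS]big_mkcond; apply: eq_bigr => s _.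
  by case: (s \in N).
have [y nz] : exists y, \sum_s to y s != 0.
  apply: contrapT => /forallNP tr0; case/eqP: N_neq0; rewrite -trN.
  by apply: big1 => p _; have /negP/negPn/eqP-> := tr0 p.1; rewrite mul0r.
set d := \sum_s _ in nz.
have dK s : to d s = d.
  rewrite /d -[LHS]/(action_mor to s _) rmorph_sum /=.
  rewrite [RHS](reindex_inj (mulIg s)); apply: eq_bigr => t _.
  by rewrite field_actM.
exists (y / d); rewrite -[RHS](divff nz) {2}/d mulr_suml; apply: eq_bigr => s _.
by rewrite -[LHS]/(action_mor to s _) fmorph_div /= /action_mor dK.
Qed.

End Separation.

(** * Maschke's theorem and semisimplicity *)

Section TwistedRingTheory.

Variables (gT : finGroupType) (L : fieldType) (to : field_action gT L).
Local Notation N := (action_kernel to).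
Local Notation TR := (twisted_ring to).
(* [L^o] gives the functions from [gT] to [L] their [L]-vector space structure,
   whereas [TR] is a module over the fixed field. *)
Local Notation V := {ffun gT -> L^o}.
Implicit Types (s t u : gT) (y z : L) (f g h : TR).

Definition twisted_scalar y : TR := twisted_mono to 1%g y.
Definition twisted_group s : TR := twisted_mono to s 1.
Local Notation c := twisted_scalar.
Local Notation d := twisted_group.

(** The vector space structure is right multiplication by L. Hence left multiplications are
    L-linear, and right ideals are subspaces having a dimension. *)
Lemma twisted_scale_vect y f : (y *: (f : V) : V) = f * c y.
Proof.
rewrite [in RHS](twisted_sumE f) mulr_suml.
under eq_bigr do rewrite twisted_ring_monoM mulg1 field_act1.
apply/ffunP=> t; rewrite sum_ffunE (bigD1 t) //= !ffunE eqxx big1 ?addr0 => [|s nst].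
  exact: mulrC.
by rewrite ffunE eq_sym (negPf nst).
Qed.

Lemma twisted_scalarM y z : c y * c z = c (y * z).
Proof. by rewrite twisted_ring_monoM mulg1 field_act1. Qed.

Lemma twisted_groupM s t : d s * d t = d (s * t)%g.
Proof.
rewrite twisted_ring_monoM mulr1 -[to 1 t]/(action_mor to t 1).
by rewrite rmorph1.
Qed.

Lemma twisted_group1 : d 1%g = 1. Proof. by []. Qed.

Lemma twisted_scalar1 : c 1 = 1. Proof. by []. Qed.

Lemma twisted_scalar_group y s : c y * d s = d s * c (to y s).
Proof.
rewrite !twisted_ring_monoM mul1g !mulg1 mulr1 -[to 1 1%g]/(action_mor to 1%g 1).
by rewrite rmorph1 mul1r.
Qed.

Lemma twisted_monoE s y : twisted_mono to s y = d s * c y.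
Proof. by rewrite twisted_ring_monoM mulg1 field_act1 mul1r. Qed.

Lemma twisted_ring_ind (P : TR -> Prop) :
  (forall f g, P f -> P g -> P (f + g)) -> (forall f g, P f -> P g -> P (f * g)) ->
  (forall s, P (d s)) -> (forall y, P (c y)) -> forall f, P f.
Proof.
move=> PD PM Pd Pc f; rewrite (twisted_sumE f).
apply: big_ind => // [|s _]; first by have := Pc 0; rewrite /c raddf0.
by rewrite twisted_monoE; apply: PM.
Qed.

Definition right_ideal (U : {vspace V}) :=
  forall f g, (f : V) \in U -> ((f * g : TR) : V) \in U.

Fact twisted_mulr_is_linear f : linear (fun g : V => (f * (g : TR) : TR) : V).
Proof.
move=> y g h; rewrite !twisted_scale_vect.
by rewrite -[RHS]/((f * g * c y + f * h) : TR) -mulrA -mulrDr.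
Qed.

Definition twisted_lmul f : 'Hom(V, V) :=
  linfun (HB.pack (fun g : V => (f * (g : TR) : TR) : V)
    (GRing.isLinear.Build L V V *:%R _ (twisted_mulr_is_linear f)) : {linear V -> V}).

Lemma twisted_lmulE f g : twisted_lmul f g = f * g.
Proof. by rewrite lfunE. Qed.

Lemma lfun_twisted_scalar (l : 'Hom(V, V)) f y :
  l (f * c y : TR) = (l f : TR) * c y.
Proof. by rewrite -[f * c y]twisted_scale_vect linearZ /= twisted_scale_vect. Qed.

Hypothesis N_neq0 : (#|N|%:R : L) != 0.

Lemma maschke (U : {vspace V}) : right_ideal U ->
  exists pi : 'Hom(V, V), [/\ forall f, pi f \in U,
    forall f, (f : V) \in U -> pi f = f
  & forall f g, pi (f * g : TR) = ((pi f : TR) * g : TR)].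
Proof.
move=> idU; have [y tr_y] := exists_trace1 N_neq0.
(* An L-linear projection averaged over G, with the weight [y] of trace 1 in place of 1/|G|. *)
pose p f : TR := \sum_s (projv U (f * d s^-1%g : TR) : TR) * c y * d s.
have p_add : {morph p : f g / f + g}.
  move=> f g; rewrite /p -big_split; apply: eq_bigr => s _ /=.
  rewrite -!mulrDl; congr (_ * _ * _); rewrite mulrDl.
  exact: (linearD (projv U)).
have pM g : forall f, p (f * g) = p f * g.
  elim/twisted_ring_ind: g => [g h IHg IHh|g h IHg IHh|t|z] f.
  - by rewrite !mulrDr p_add IHg IHh.
  - by rewrite !mulrA IHh IHg.
  - rewrite /p (reindex_inj (mulIg t)) mulr_suml; apply: eq_bigr => s _ /=.
    rewrite -twisted_groupM !mulrA -[f * _ * _]mulrA twisted_groupM.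
    by rewrite invMg mulKVg.
  rewrite /p mulr_suml; apply: eq_bigr => s _ /=.
  rewrite -[f * c z * _]mulrA twisted_scalar_group [f * _]mulrA lfun_twisted_scalar.
  (* The scalar [z] is twisted on passing one group element and untwisted on passing its inverse; in
     between it commutes with [y] and the L-linear projection. *)
  have dcz : d s * c z = c (to z s^-1%g) * d s.
    by rewrite twisted_scalar_group -field_actM mulVg field_act1.
  rewrite -[in RHS]mulrA dcz !mulrA; congr (_ * _).
  by rewrite -!mulrA !twisted_scalarM mulrC.
have p_lin : linear (p : V -> V).
  by move=> z f g; rewrite !twisted_scale_vect -pM -p_add.
pose pl : {linear V -> V} :=
  HB.pack (p : V -> V) (GRing.isLinear.Build L V V *:%R _ p_lin).
exists (linfun pl); split=> [f|f Uf|f g]; rewrite !lfunE /=; last exact: pM.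
  rewrite /p; apply: (big_ind (fun f : TR => (f : V) \in U)) => [|g h|s _].
  - exact: mem0v.
  - exact: memvD.
  by apply: (idU); apply: (idU); exact: memv_proj.
rewrite /p; under eq_bigr => s _.
  rewrite projv_id; last exact: idU.
  rewrite -mulrA twisted_scalar_group !mulrA -[f * _ * _]mulrA twisted_groupM.
  rewrite mulVg twisted_group1 mulr1.
  over.
by rewrite -mulr_sumr -raddf_sum tr_y mulr1.
Qed.

(** Induction on dimension: a nonzero right ideal [M] of least dimension inside [U] is generated by
    each of its nonzero elements, hence is an image of some [X i]. The Maschke projection onto [M]
    leaves a remainder in a smaller right ideal. *)
Lemma ideal_in_socle (k : nat) (X : 'I_k -> lmodType TR^c) :
  simple_representatives X ->
  forall U : {vspace V}, right_ideal U ->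
  forall f, (f : V) \in U -> in_socle X (f : TR^c).
Proof.
move=> hX U; have [n] := ubnP (\dim U); elim: n U => // n IHn U /ltnSE leUn idU f Uf.
have [U0|nzU] := eqVneq U 0%VS.
  by move: Uf; rewrite U0 memv0 => /eqP->; exact: in_socle0.
pose P m := `[< exists M : {vspace V},
  [/\ right_ideal M, (M <= U)%VS, M != 0%VS & \dim M = m] >].
have exP : exists m, P m by exists (\dim U); apply/asboolP; exists U.
case: (ex_minnP exP) => m /asboolP[M [idM leMU nzM dimM]] minM.
have cycM (x y : TR) : (x : V) \in M -> x != 0 -> (y : V) \in M ->
    exists a : TR^c, (y : TR^c^o) = a *: (x : TR^c^o).
  move=> Mx nzx My; set W := limg (twisted_lmul x).
  have leWM : (W <= M)%VS.
    by apply/subvP=> _ /memv_imgP[g _ ->]; rewrite twisted_lmulE; exact: idM.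
  have idW : right_ideal W.
    move=> _ h /memv_imgP[g _ ->]; rewrite twisted_lmulE -mulrA -twisted_lmulE.
    exact: memv_img (memvf _).
  have nzW : W != 0%VS.
    apply: contra nzx => /eqP W0; have : (x : V) \in 0%VS; last by rewrite memv0.
    rewrite -W0 -[x]mulr1 -twisted_lmulE.
    exact: memv_img (memvf _).
  have defW : W = M.
    apply/eqP; rewrite eqEdim leWM dimM minM //; apply/asboolP.
    by exists W; rewrite (subv_trans leWM).
  by move: My; rewrite -defW => /memv_imgP[g _ ->]; exists g; rewrite twisted_lmulE.
have [i [F imF]] : exists i, exists F : {linear X i -> TR^c^o},
    forall y : TR^c^o, y \in [pred g : TR^c^o | (g : V) \in M] -> exists x, y = F x.
  apply: cyclic_submodule_image => //.
  - split=> [|a u v]; rewrite !inE; first exact: mem0v.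
    by move=> Mu Mv; apply: memvD => //; exact: idM.
  - have [x Mx nzx] : exists2 x, x \in M & x != 0.
      by exists (vpick M); rewrite ?memv_pick ?vpick0.
    by exists x.
have [pi [piM pi_id pi_mul]] := maschke idM.
rewrite -[f](subrK (pi f)); apply: in_socleD.
  apply: (IHn (U :&: lker pi)%VS).
  (* Were the dimension not to drop, [pi] would vanish on [M], where it is the identity. *)
  - apply: leq_trans leUn; rewrite ltnNge; apply: contra nzM.
    rewrite (geq_leqif (dimv_leqif_sup (capvSl U (lker pi)))) subv_cap subvv /= => leUK.
    rewrite -vpick0 -[vpick M]pi_id ?memv_pick // -memv_ker.
    exact: subvP (subv_trans leMU leUK) _ (memv_pick M).
  - move=> g h; rewrite !memv_cap !memv_ker => /andP[Ug /eqP pg0].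
    by rewrite idU //= pi_mul pg0 -[X in X == _]/(0 * h : TR) mul0r.
  rewrite memv_cap memv_ker linearB /= (pi_id (pi f)) // subrr eqxx andbT.
  exact: (memvB Uf (subvP leMU _ (piM f))).
have [x ->] := imF _ (piM f); exact: in_socle_image.
Qed.

End TwistedRingTheory.

(** * Class functions on the kernel *)

Section ClassFunctions.

Variables (gT : finGroupType) (L : fieldType) (to : field_action gT L).
Local Notation N := (action_kernel to).
Local Notation TR := (twisted_ring to).
Local Notation V := {ffun gT -> L^o}.
Local Notation c := (@twisted_scalar gT L to).
Local Notation d := (@twisted_group gT L to).
Implicit Types (s t u : gT) (y z : L) (f g h : TR).

Lemma twisted_sum_coef (F : gT -> L) t : (\sum_s twisted_mono to s (F s)) t = F t.
Proof.
rewrite sum_ffunE (bigD1 t) //= ffunE eqxx big1 ?addr0 // => s nst.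
by rewrite ffunE eq_sym (negPf nst).
Qed.

Lemma twisted_scalarl_coef y f t : (c y * f) t = to y t * f t.
Proof.
rewrite [in LHS](twisted_sumE f) mulr_sumr.
under eq_bigr do rewrite twisted_ring_monoM mul1g.
exact: twisted_sum_coef.
Qed.

Lemma twisted_scalarr_coef y f t : (f * c y) t = f t * y.
Proof.
rewrite [in LHS](twisted_sumE f) mulr_suml.
under eq_bigr do rewrite twisted_ring_monoM mulg1 field_act1.
exact: twisted_sum_coef.
Qed.

Lemma twisted_groupl_coef s f t : (d s * f) (s * t)%g = f t.
Proof.
rewrite [in LHS](twisted_sumE f) mulr_sumr (reindex_inj (mulgI s^-1%g)).
under eq_bigr => u _.
  rewrite twisted_ring_monoM mulKVg -[to 1 _]/(action_mor to _ 1) rmorph1 mul1r.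
  over.
by rewrite twisted_sum_coef mulKg.
Qed.

Lemma twisted_groupr_coef s f t : (f * d s) (t * s)%g = to (f t) s.
Proof.
rewrite [in LHS](twisted_sumE f) mulr_suml (reindex_inj (mulIg s^-1%g)).
under eq_bigr do rewrite twisted_ring_monoM mulgKV mulr1.
by rewrite twisted_sum_coef mulgK.
Qed.

Definition kernel_class_fun (f : gT -> L) :=
  (forall s, s \notin N -> f s = 0) /\
  (forall s t, t \in N -> f (s ^ t)%g = f s).

(** Commuting with L gives y^s f(s) = y f(s), so the support lies in N. Commuting with [t] gives
    f(s^t) = f(s)^t, which is f(s) for [t] in N. *)
Lemma central_kernel_class_fun f : (forall g, f * g = g * f) -> kernel_class_fun f.
Proof.
move=> fC; split=> [s sN|s t tN].
  apply: contraNeq sN => nz; apply/action_kernelP => y; apply: (mulIf nz).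
  by rewrite -twisted_scalarl_coef -fC twisted_scalarr_coef mulrC.
rewrite -(twisted_groupl_coef t) -fC -conjgC twisted_groupr_coef.
exact: (action_kernelP _ _ tN).
Qed.

Lemma kernel_class_fun_scalar f y : kernel_class_fun f -> c y * f = f * c y.
Proof.
move=> [f0 _]; apply/ffunP=> s; rewrite twisted_scalarl_coef twisted_scalarr_coef.
have [sN|/f0->] := boolP (s \in N); last by rewrite mulr0 mul0r.
by rewrite (action_kernelP _ _ sN) mulrC.
Qed.

Lemma kernel_class_fun_group f t : kernel_class_fun f -> t \in N -> f * d t = d t * f.
Proof.
move=> [_ fJ] tN; apply/ffunP=> s; rewrite -(mulgKV t s) twisted_groupr_coef.
set u := (s * _)%g; rewrite conjgC twisted_groupl_coef fJ //.
exact: (action_kernelP _ _ tN).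
Qed.

Definition class_indicators : #|classes N|.-tuple V :=
  [tuple [ffun s => (s \in enum_val i)%:R] | i < #|classes N|].

Lemma kernel_class_fun_indicator (C : {set gT}) :
  C \in classes N -> kernel_class_fun (fun s => (s \in C)%:R).
Proof.
case/imsetP=> u uN ->; split=> [s sN|s t tN].
  case: imsetP => // -[t tN def_s]; case/negP: sN.
  by rewrite def_s groupJ.
by rewrite class_sym classGidl // class_sym.
Qed.

Lemma class_indicatorsE i s : tnth class_indicators i s = (s \in enum_val i)%:R.
Proof. by rewrite tnth_mktuple ffunE. Qed.

Lemma mem_class_index (i : 'I_#|classes N|) s :
  s \in enum_val i -> enum_val i = (s ^: N)%g :> {set gT}.
Proof. by have /imsetP[u _ ->] := enum_valP i; move=> /class_eqP->. Qed.

Lemma class_indicators_free : free class_indicators.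
Proof.
apply/freeP=> a a0 i; have /imsetP[u uN def_i] := enum_valP i.
have ui : u \in enum_val i by rewrite def_i class_refl.
have {}a0 : \sum_j a j *: tnth class_indicators j = 0.
  by rewrite -[RHS]a0; apply: eq_bigr => j _; rewrite (tnth_nth 0).
have /ffunP/(_ u) := a0; rewrite sum_ffunE ffunE (bigD1 i) //= big1 => [|j nji].
  by rewrite addr0 ffunE class_indicatorsE ui /= [_ *: _]mulr1.
rewrite ffunE class_indicatorsE.
case: (boolP (u \in enum_val j)) => [/mem_class_index def_j|_]; last exact: scaler0.
by case/eqP: nji; apply: enum_val_inj; rewrite def_j (mem_class_index ui).
Qed.

Lemma kernel_class_fun_span f :
  kernel_class_fun f -> (f : V) \in <<class_indicators>>%VS.
Proof.
move=> [f0 fJ].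
have -> : f = \sum_i (f (repr (enum_val i)) : L) *: tnth class_indicators i :> V.
  apply/ffunP=> s; rewrite sum_ffunE; have [sN|sN] := boolP (s \in N).
    have CsN := mem_classes sN; pose i := enum_rank_in CsN (s ^: N)%g.
    have def_i : enum_val i = (s ^: N)%g by rewrite enum_rankK_in.
    rewrite (bigD1 i) //= big1 ?addr0 => [|j nji].
      rewrite ffunE class_indicatorsE def_i class_refl [RHS]mulr1.
      have /imsetP[t tN ->] : repr (s ^: N)%g \in (s ^: N)%g.
        exact: mem_repr (class_refl _ _).
      by rewrite fJ.
    rewrite ffunE class_indicatorsE.
    case: (boolP (s \in enum_val j)) => [/mem_class_index def_j|_]; last exact: scaler0.
    by case/eqP: nji; apply: enum_val_inj; rewrite def_j def_i.
  rewrite f0 // big1 // => i _; rewrite ffunE class_indicatorsE.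
  have [indN _] := kernel_class_fun_indicator (enum_valP i).
  by rewrite indN // [LHS]mulr0.
apply: memv_suml => i _; apply: memvZ; apply: memv_span; exact: mem_tnth.
Qed.

End ClassFunctions.

(** * Class functions as L-combinations of central elements *)

Section Descent.

Variables (gT : finGroupType) (L : fieldType) (to : field_action gT L).
Local Notation N := (action_kernel to).
Local Notation TR := (twisted_ring to).
Local Notation c := (@twisted_scalar gT L to).
Local Notation d := (@twisted_group gT L to).
Implicit Types (s t u : gT) (y z : L) (f g h : TR).

Definition conj_trace f : TR := \sum_s d s^-1%g * f * d s.

(** Summing over G gives commutation with G; every conjugate of [f] by a group element still
    commutes with L. *)
Lemma conj_trace_central f :
  (forall y, c y * f = f * c y) -> forall g, conj_trace f * g = g * conj_trace f.
Proof.
move=> fC; elim/twisted_ring_ind => [g h IHg IHh|g h IHg IHh|t|y].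
- by rewrite mulrDl mulrDr IHg IHh.
- by rewrite mulrA IHg -mulrA IHh mulrA.
- rewrite /conj_trace mulr_suml mulr_sumr [RHS](reindex_inj (mulIg t)).
  apply: eq_bigr => s _.
  by rewrite -mulrA twisted_groupM !mulrA twisted_groupM invMg mulKVg.
rewrite /conj_trace mulr_suml mulr_sumr; apply: eq_bigr => s _.
rewrite !mulrA twisted_scalar_group -[_ * c _ * f]mulrA fC.
rewrite -!mulrA; congr (_ * (_ * _)).
by rewrite twisted_scalar_group -field_actM mulVg field_act1.
Qed.

Hypothesis N_neq0 : (#|N|%:R : L) != 0.

(** By separation, the sum of the T(f a_j) b_j keeps only the conjugates of [f] by elements of N.
    Each of these equals [f], so the sum is |N| f. *)
Lemma kernel_class_fun_descent f : kernel_class_fun to f ->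
  exists r : seq (TR * L), f = \sum_(p <- r) p.1 * c p.2
    /\ forall p, p \in r -> forall g, p.1 * g = g * p.1.
Proof.
move=> fN; have [r rE] := tensorial_kernel to.
exists [seq (conj_trace (f * c p.1), p.2 / #|N|%:R) | p <- r]; split; last first.
  move=> _ /mapP[p _ ->] /=; apply: conj_trace_central => y.
  rewrite mulrA kernel_class_fun_scalar // -!mulrA !twisted_scalarM.
  by rewrite [p.1 * y]mulrC.
rewrite big_map /=.
have term p s : d s^-1%g * (f * c p.1) * d s * c (p.2 / #|N|%:R)
    = d s^-1%g * f * d s * c (to p.1 s * p.2) * c #|N|%:R^-1.
  rewrite [d s^-1%g * (f * _)]mulrA -[_ * c p.1 * d s]mulrA twisted_scalar_group.
  by rewrite mulrA -[LHS]mulrA -[RHS]mulrA !twisted_scalarM mulrA.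
under eq_bigr do rewrite /conj_trace mulr_suml; rewrite exchange_big /=.
under eq_bigr => s _.
  under eq_bigr do rewrite term.
  rewrite -mulr_suml -mulr_sumr -raddf_sum -rE.
  over.
rewrite -mulr_suml (bigID (mem N)) /= [X in _ + X]big1 => [|s /negPf->]; last first.
  by rewrite /twisted_scalar raddf0 mulr0.
rewrite addr0 (eq_bigr (fun=> f)) => [|s sN].
  rewrite sumr_const mulrnAl -mulrnAr /twisted_scalar -raddfMn /=.
  rewrite -[_^-1 *+ _]mulr_natr mulVf // -/(twisted_scalar to 1).
  by rewrite twisted_scalar1 mulr1.
rewrite sN -[twisted_mono to 1%g _]/(1 : TR) mulr1 -mulrA.
rewrite kernel_class_fun_group // mulrA.
by rewrite twisted_groupM mulVg twisted_group1 mul1r.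
Qed.

End Descent.

(** * Comparison of the two bases *)

Theorem corollary1p30 (gT : finGroupType) (L : fieldType)
    (to : field_action gT L)
    (hn : (#|action_kernel to|%:R : fixed_field to) \is a GRing.unit)
    (k : nat) (X : 'I_k -> lmodType (twisted_ring to)^c)
    (hX : simple_representatives X)
    (hK : forall i : 'I_k,
        endomorphisms_are_scalars (K := fixed_field to) (A := twisted_ring to)
          (X i)) :
  k = #|classes (action_kernel to)|.
Proof.
set N := action_kernel to; pose TR := twisted_ring to.
pose V := {ffun gT -> L^o}.
have N_neq0 : (#|N|%:R : L) != 0.
  move: hn; rewrite unitfE; apply: contraNneq => N0.
  by apply/eqP; apply: val_inj; rewrite raddfMn /= N0.
have [e [e_id e_0 faith]] : exists e : 'I_k -> TR^c,
    [/\ forall i (x : X i), e i *: x = x,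
        forall i j (x : X j), i != j -> e i *: x = 0
      & forall b, annihilates X b -> b = 0].
  apply: in_socle1_idempotents; apply: (ideal_in_socle N_neq0 hX (U := fullv)).
    by move=> f g _; exact: memvf.
  exact: memvf.
have actM (a b : TR) i (x : X i) :
  ((a * b : TR) : TR^c) *: x = (b : TR^c) *: ((a : TR^c) *: x).
  by rewrite scalerA.
have e_central i (a : TR) : (e i : TR) * a = a * (e i : TR).
  apply/eqP; rewrite -subr_eq0; apply/eqP; apply: faith => j.
  have [<-{j}|nij] := eqVneq i j => x; rewrite scalerBl !actM.
    by rewrite !e_id subrr.
  by rewrite !(e_0 i j) // scaler0 subrr.
(* A central [z] acts on [X i] by an endomorphism, hence by a scalar thanks to [hK]; faithfulness
   turns equality of actions into equality in A. *)
have central_span (z : TR) : (forall g, z * g = g * z) ->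
    exists kappa : 'I_k -> L, z = \sum_i (e i : TR) * twisted_scalar to (kappa i).
  move=> zC; have kappa_ex i : exists a : L,
      forall x : X i, (z : TR^c) *: x = (twisted_scalar to a : TR^c) *: x.
    pose phi (x : X i) := (z : TR^c) *: x.
    have phi_lin : linear phi.
      by move=> a u v; rewrite /phi scalerDr -!actM zC.
    pose Phi : {linear X i -> X i} :=
      HB.pack phi (GRing.isLinear.Build _ _ _ _ phi phi_lin).
    have [a aE] := hK i Phi; exists (fixed_val a) => x; rewrite -[LHS]/(Phi x) aE.
    by rewrite /scalar_endo twisted_scale_mono mul1r.
  have [kappa kappaE] := fin_all_exists kappa_ex.
  exists kappa; apply/eqP; rewrite -subr_eq0; apply/eqP; apply: faith => j x.
  rewrite scalerBl scaler_suml (bigD1 j) //= big1 => [|i nij].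
    by rewrite addr0 actM e_id kappaE subrr.
  by rewrite actM e_0 // scaler0.
pose E : k.-tuple V := [tuple (e i : V) | i < k].
have E_free : free E.
  apply/freeP=> a a0 j.
  have {}a0 : \sum_i (e i : TR) * twisted_scalar to (a i) = 0.
    rewrite -[RHS]a0; apply: eq_bigr => i _.
    by rewrite -tnth_nth tnth_mktuple; symmetry; exact: twisted_scale_vect.
  (* Acting on [X j], the relation reduces to [a j] killing [x]; a nonzero [a j] is invertible in
     A. *)
  have [simX _ _] := hX; have [[x nzx] _] := simX j.
  apply: contraNeq nzx => nza; rewrite -[x]scale1r.
  have -> : (1 : TR^c) = twisted_scalar to (a j * (a j)^-1) :> TR by rewrite divff.
  rewrite -twisted_scalarM actM.
  suff -> : (twisted_scalar to (a j) : TR^c) *: x = 0 by rewrite scaler0.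
  rewrite -[RHS](scale0r x) -[in RHS]a0 scaler_suml (bigD1 j) //=.
  rewrite big1 ?addr0 => [|i nij].
    by rewrite actM e_id.
  by rewrite actM e_0 // scaler0.
have spanE : <<E>>%VS = <<class_indicators to>>%VS.
  apply/eqP; rewrite eqEsubv; apply/andP; split; apply/span_subvP.
    move=> _ /tnthP[i ->]; rewrite tnth_mktuple; apply: kernel_class_fun_span.
    exact: central_kernel_class_fun (e_central i).
  move=> _ /tnthP[i ->].
  have : kernel_class_fun to (tnth (class_indicators to) i).
    have [ind0 indJ] := kernel_class_fun_indicator (enum_valP i).
    by split=> [s sN|s t tN]; rewrite !class_indicatorsE; [exact: ind0 | exact: indJ].
  case/(kernel_class_fun_descent N_neq0) => r [-> rC].
  rewrite big_seq; apply: (big_ind (fun f : TR => (f : V) \in <<E>>%VS)).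
  - exact: mem0v.
  - by move=> f g; exact: memvD.
  move=> p /rC/central_span[kappa ->]; rewrite -twisted_scale_vect memvZ //.
  apply: (big_ind (fun f : TR => (f : V) \in <<E>>%VS)).
  - exact: mem0v.
  - by move=> f g; exact: memvD.
  move=> j _; rewrite -twisted_scale_vect memvZ // memv_span //.
  by apply/tnthP; exists j; rewrite tnth_mktuple.
(* Both free families have as length the dimension of their common span. *)
move: E_free (class_indicators_free to); rewrite /free spanE !size_tuple.
by move=> /eqP <- /eqP.
Qed.
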